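(* Let $n\ge2$ be an integer, let $f=(f_1,\ldots,f_n)$ be a sequence of symbols, and let $|f|=(|f_1|,\ldots,|f_n|)\in\mathbb{Z}^n$ be its sequence of degrees. Let the group $\{\pm1\}$ be endowed with the $S_n$-module structure defined by a group morphism $u:S_n\to\{\pm1\}$. Then the map $$c_f:S_n\times S_n\to\{\pm1\},\qquad c_f(\sigma,\rho)=\kappa_f(\sigma,\rho(f)),$$ where $\kappa_f$ is the Koszul sign map of $f$, is a 2-cocycle with coefficients in the group $\{\pm1\}$ if and only if either all the integers $|f_1|,\ldots,|f_n|$ have the same parity or only one is odd among them. When this condition holds, $u=1$ (the constant morphism) if and only if all the integers $|f_1|,\ldots,|f_n|$ are even, with possibly one exception, and $u=\mathrm{sgn}$ (the signature) if and only if all the integers $|f_1|,\ldots,|f_n|$ are odd. Moreover, in both cases, $c_f$ is equal to the coboundary of $u$, i.e. $c_f=\delta(u)$.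
   Context: Symbols are formal objects, each assigned a degree in $\mathbb{Z}$; the degree of $f_i$ is denoted $|f_i|$. $S_n$ is the group of permutations of $\{1,\ldots,n\}$ and $s_i=(i,i+1)$ for $1\le i\le n-1$. The set of permutations of $f$ is $$\mathcal{E}_f=\{g=(g_1,\ldots,g_n)\,:\,\exists\rho\in S_n,\ g_i=f_{\rho^{-1}(i)}\text{ for } i=1,\ldots,n\},$$ with degrees $|g_i|=|f_{\rho^{-1}(i)}|$. The group $S_n$ acts on the left on $\mathcal{E}_f$ by $\sigma(g)=(g_{\sigma^{-1}(1)},\ldots,g_{\sigma^{-1}(n)})$. The Koszul sign map $\kappa_f:S_n\times\mathcal{E}_f\to\{\pm1\}$ is the unique map such that (1) $\kappa_f(\sigma\tau,g)=\kappa_f(\sigma,\tau(g))\,\kappa_f(\tau,g)$ for all $\sigma,\tau\in S_n$ and $g\in\mathcal{E}_f$; and (2) $\kappa_f(s_i,g)=(-1)^{|g_i||g_{i+1}|}$ for all $i\in\{1,\ldots,n-1\}$ and $g\in\mathcal{E}_f$. Given a group morphism $u:S_n\to\{\pm1\}$ (the only ones are the constant morphism $1$ and the signature $\mathrm{sgn}$), the $S_n$-module structure on $\{\pm1\}$ defined by $u$ means that $\sigma\in S_n$ acts on $\varepsilon\in\{\pm1\}$ by the product $\sigma.\varepsilon=u(\sigma)\,\varepsilon$. The coboundary operator $\delta$ for this structure is given on a 1-cochain $v:S_n\to\{\pm1\}$ by $$\delta(v)(\sigma,\tau)=(\sigma.v(\tau))\,v(\sigma\tau)^{-1}\,v(\sigma)=u(\sigma)\,v(\tau)\,v(\sigma\tau)^{-1}\,v(\sigma),$$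 and on a 2-cochain $c:S_n\times S_n\to\{\pm1\}$ by $$\delta(c)(\sigma,\tau,\rho)=(\sigma.c(\tau,\rho))\,c(\sigma\tau,\rho)^{-1}\,c(\sigma,\tau\rho)\,c(\sigma,\tau)^{-1}=u(\sigma)\,c(\tau,\rho)\,c(\sigma\tau,\rho)^{-1}\,c(\sigma,\tau\rho)\,c(\sigma,\tau)^{-1}.$$ A 2-cochain $c$ is a 2-cocycle if $\delta(c)$ is constant equal to $1$.
   Formalization: The first equivalence is stated as ''c_f is a 2-cocycle for some morphism u iff the parity condition holds'' (for a fixed u it fails: all degrees even, u = sgn); the second paragraph is stated for every u for which c_f is a 2-cocycle. *)

(* Defs.v *)
From HB Require Import structures.
From mathcomp Require Import all_boot all_order all_fingroup all_algebra zify.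

Set Implicit Arguments.
Unset Strict Implicit.
Unset Printing Implicit Defensive.

Import GRing.Theory.
Local Open Scope ring_scope.

(* The group {±1} is the set of the two units of [int]: maps into it are
   [int]-valued maps all of whose values satisfy [is_pm1]. *)
Definition is_pm1 (x : int) : Prop := x = 1 \/ x = -1.

Definition oddz (x : int) : bool := ~~ (2 %| x)%Z.

(* The product of S_n as composition of maps, (σ ∘ τ)(i) = σ(τ(i)).  The product
   [mulg] on ['S_n] is in the opposite order: (s * t)%g i = t (s i). *)
Definition permcomp n (s t : 'S_n) : 'S_n := (t * s)%g.

Definition pact (T : Type) n (s : 'S_n) (g : {ffun 'I_n -> T}) :
  {ffun 'I_n -> T} := [ffun i => g ((s^-1)%g i)].

Definition rearrangement (T : Type) n (f g : {ffun 'I_n -> T}) : Prop :=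
  exists r : 'S_n, g = pact r f.

(* Only the values of [kappa] on the rearrangements of [f] are constrained.
   In the last clause [tperm i j] is the simple transposition (i, i+1). *)
Definition is_koszul_sign (T : Type) (deg : T -> int) n (f : {ffun 'I_n -> T})
    (kappa : 'S_n -> {ffun 'I_n -> T} -> int) : Prop :=
  [/\ forall (s : 'S_n) g, rearrangement f g -> is_pm1 (kappa s g),
      forall (s t : 'S_n) g, rearrangement f g ->
        kappa (permcomp s t) g = kappa s (pact t g) * kappa t g
    & forall (i j : 'I_n) g, rearrangement f g -> j = i.+1 :> nat ->
        kappa (tperm i j) g = (-1) ^ (deg (g i) * deg (g j))].

Definition koszul_cochain (T : Type) n
    (kappa : 'S_n -> {ffun 'I_n -> T} -> int) (f : {ffun 'I_n -> T})
    (s r : 'S_n) : int := kappa s (pact r f).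

Definition sign_morphism n (u : 'S_n -> int) : Prop :=
  (forall s, is_pm1 (u s)) /\ (forall s t, u (permcomp s t) = u s * u t).

Definition signature n (s : 'S_n) : int := (-1) ^+ odd_perm s.

Definition delta1 n (u v : 'S_n -> int) (s t : 'S_n) : int :=
  (u s * v t) * (v (permcomp s t))^-1 * v s.

Definition delta2 n (u : 'S_n -> int) (c : 'S_n -> 'S_n -> int)
    (s t r : 'S_n) : int :=
  (u s * c t r) * (c (permcomp s t) r)^-1 * c s (permcomp t r) * (c s t)^-1.

Definition is_2cocycle n (u : 'S_n -> int) (c : 'S_n -> 'S_n -> int) : Prop :=
  (forall s t, is_pm1 (c s t)) /\ (forall s t r, delta2 u c s t r = 1).

Lemma pactM (T : Type) n (s t : 'S_n) (g : {ffun 'I_n -> T}) :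
  pact (permcomp s t) g = pact s (pact t g).
Proof. by apply/ffunP=> i; rewrite !ffunE /permcomp invMg permM. Qed.

Lemma rearrangement_act (T : Type) n (f g : {ffun 'I_n -> T}) (s : 'S_n) :
  rearrangement f g -> rearrangement f (pact s g).
Proof. by case=> r ->; exists (permcomp s r); rewrite pactM. Qed.

Lemma sum_lt_perm n (F : 'I_n -> 'I_n -> nat) (t : 'S_n) :
  (forall i j, F i j = F j i) ->
  (\sum_(i < n) \sum_(j < n | i < j) F (t i) (t j)
    = \sum_(i < n) \sum_(j < n | i < j) F i j)%N.
Proof.
move=> symF.
have dbl (G : 'I_n -> 'I_n -> nat) : (forall i j, G i j = G j i) ->
  (\sum_(i < n) \sum_(j < n | j != i) G i j
    = (\sum_(i < n) \sum_(j < n | i < j) G i j).*2)%N.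
  move=> symG; rewrite -addnn.
  have {2}-> : (\sum_(i < n) \sum_(j < n | i < j) G i j
      = \sum_(i < n) \sum_(j < n | j < i) G i j)%N.
    rewrite (exchange_big_dep predT) //=; apply: eq_bigr => i _.
    by apply: eq_bigr => j _; apply: symG.
  rewrite -big_split; apply: eq_bigr => i _ /=.
  rewrite (bigID (fun j : 'I_n => i < j)%N) /=.
  congr (_ + _)%N; apply: eq_bigl => j; rewrite -val_eqE /=; by case: ltngtP.
apply: double_inj; rewrite -!dbl //.
rewrite [RHS](reindex_inj (@perm_inj _ t)) /=; apply: eq_bigr => i _.
rewrite [RHS](reindex_inj (@perm_inj _ t)) /=.
by apply: eq_bigl => j; rewrite (inj_eq perm_inj).
Qed.

Lemma koszul_sign_exists (T : Type) (deg : T -> int) n (f : {ffun 'I_n -> T}) :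
  exists kappa, is_koszul_sign deg f kappa.
Proof.
pose w (g : {ffun 'I_n -> T}) i j := oddz (deg (g i)) && oddz (deg (g j)).
pose V (s : 'S_n) (i j : 'I_n) := ((i < j) (+) (s i < s j))%N.
pose E s g := (\sum_(i < n) \sum_(j < n | i < j) (V s i j && w g i j))%N.
have Vsym s i j : i != j -> V s i j = V s j i.
  move=> ij; have sij : s i != s j by rewrite (inj_eq perm_inj).
  by rewrite /V; move: ij sij; rewrite -!val_eqE /=; lia.
have Vs (i j k l : 'I_n) : j = i.+1 :> nat -> (k < l)%N ->
    V (tperm i j) k l = (k == i) && (l == j).
  move=> ji kl; rewrite /V kl -!val_eqE /=.
  rewrite !permE /= -!val_eqE /=.
  by do ?case: ifP; lia.
exists (fun s g => (-1) ^+ E s g); split.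
- by move=> s g _; rewrite -signr_odd; case: odd; [right | left].
- move=> s t g _; rewrite -exprD -signr_odd -[RHS]signr_odd.
  congr (_ ^+ nat_of_bool _).
  pose F i j : nat := (i != j) && (V s i j && w (pact t g) i j).
  have Fsym i j : F i j = F j i.
    rewrite /F eq_sym; case: (eqVneq j i) => //= ji.
    by rewrite (Vsym _ _ _ ji) /w [w in _ && w]andbC.
  have -> : E s (pact t g) = (\sum_(i < n) \sum_(j < n | i < j) F (t i) (t j))%N.
    rewrite sum_lt_perm //; apply: eq_bigr => i _; apply: eq_bigr => j ij.
    by rewrite /F -val_eqE /= neq_ltn ij.
  rewrite /E -big_split /=.
  apply: (big_ind2 (fun a b => odd a = odd b))
    => // [a b c d|i _]; first by rewrite !oddD => -> ->.
  rewrite -big_split /=.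
  apply: (big_ind2 (fun a b => odd a = odd b))
    => // [a b c d|j ij]; first by rewrite !oddD => -> ->.
  rewrite oddD !oddb /F (inj_eq perm_inj) -val_eqE /= neq_ltn ij /=.
  rewrite /w !ffunE !permK /V /permcomp !permM ij.
  by case: (oddz _ && _); rewrite ?andbF //= !andbT; do 2!case: (_ < _)%N.
- move=> i j g _ ji; have ij : (i < j)%N by rewrite ji.
  have -> : E (tperm i j) g = w g i j.
    rewrite /E (bigD1 i) //= (bigD1 j) //= !big1 ?addn0.
    + by rewrite Vs // !eqxx.
    + by move=> k ki; apply: big1 => l kl; rewrite Vs // (negbTE ki).
    + by move=> l /andP[il lj]; rewrite Vs // (negbTE lj) andbF.
  rewrite /w; set a := deg (g i); set b := deg (g j).
  have ww (m : int) : (-1) ^ m = (-1) ^+ oddz m :> int.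
    have -> : oddz m = odd `|m| by rewrite /oddz dvdzE /= dvdn2 negbK.
    by case: m => m; rewrite signr_odd // -exprnN invr_sign.
  rewrite ww; congr (_ ^+ nat_of_bool _).
  by rewrite /oddz !dvdzE abszM !dvdn2 oddM !negbK.
Qed.

Lemma koszul_sign_unique (T : Type) (deg : T -> int) n (f : {ffun 'I_n -> T})
    (k1 k2 : 'S_n -> {ffun 'I_n -> T} -> int) :
  is_koszul_sign deg f k1 -> is_koszul_sign deg f k2 ->
  forall s g, rearrangement f g -> k1 s g = k2 s g.
Proof.
move=> [v1 m1 t1] [v2 m2 t2].
pose P (s : 'S_n) := forall g, rearrangement f g -> k1 s g = k2 s g.
have P1 : P 1%g.
  have k_one k : (forall (s : 'S_n) g, rearrangement f g -> is_pm1 (k s g)) ->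
      (forall (s t : 'S_n) g, rearrangement f g ->
        k (permcomp s t) g = k s (pact t g) * k t g) ->
      forall g, rearrangement f g -> k 1%g g = 1.
    move=> v m g fg; have := m 1%g 1%g g fg.
    have -> : pact 1%g g = g by apply/ffunP=> i; rewrite ffunE invg1 perm1.
    by rewrite /permcomp mulg1; case: (v 1%g g fg) => ->.
  by move=> g fg; rewrite !k_one.
have PM s t : P s -> P t -> P (t * s)%g.
  by move=> Ps Pt g fg; rewrite m1 // m2 // Ps ?Pt //; apply: rearrangement_act.
have Pts d : forall i j : 'I_n, j = (i + d.+1)%N :> nat -> P (tperm i j).
  elim: d => [|d IH] i j ji.
    by move=> g fg; rewrite t1 ?t2 // ji addn1.
  have kn : (i + d.+1 < n)%N by have := ltn_ord j; lia.
  pose k := Ordinal kn.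
  have Pik : P (tperm i k) by apply: IH.
  have Pkj : P (tperm k j) by move=> g fg; rewrite t1 ?t2 // ji addnS.
  have -> : tperm i j = (tperm k j * (tperm i k * tperm k j))%g.
    rewrite -[X in (X * _)%g]tpermV -/(conjg _ _) tpermJ tpermL tpermD //;
      rewrite -val_eqE /=; lia.
  exact: PM (PM _ _ Pkj Pik) Pkj.
have Pt (i j : 'I_n) : P (tperm i j).
  wlog ij : i j / (i <= j)%N => [W|].
    by case: (leqP i j) => [|/ltnW] /W //; rewrite tpermC.
  have [->|ne] := eqVneq i j; first by rewrite tperm1.
  by apply: (Pts (j - i).-1); move: ne; rewrite -val_eqE /=; lia.
move=> s; have [ts -> _] := prod_tpermP s; apply: (big_ind P).
- exact: P1.
- by move=> a b Pa Pb; apply: PM.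
- by case=> i j _; apply: Pt.
Qed.

(* Main.v *)
(* The Koszul relation gives c_f(st, r) = c_f(s, tr) c_f(t, r), so that
   delta(c_f)(s, t, r) = u(s) c_f(s, t): the cocycle condition says exactly that
   kappa_f(s, g) = u(s) for every rearrangement g of f.  Evaluated at one simple
   transposition, this forces (-1)^(|f_i||f_j|) to be the same sign for all
   i != j, since any two entries of f can be moved to two given positions.  That
   sign is -1 iff all degrees are odd, and 1 iff at most one of them is.
   Conversely sgn, resp. 1, then satisfies the axioms of the Koszul sign, hence
   is equal to it. *)

Require Import Defs.
From mathcomp Require Import all_boot all_order all_fingroup all_algebra.

Set Implicit Arguments.
Unset Strict Implicit.
Unset Printing Implicit Defensive.

Import GRing.Theory.
Local Open Scope ring_scope.

Lemma is_pm1_mulzz (x : int) : is_pm1 x -> x * x = 1.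
Proof. by case=> ->. Qed.

Lemma is_pm1_inv (x : int) : is_pm1 x -> x^-1 = x.
Proof. by case=> ->. Qed.

Lemma is_pm1_signr (b : bool) : is_pm1 ((-1) ^+ b).
Proof. by case: b; [right | left]. Qed.

(** A negative exponent only inverts a sign, so the parity of the exponent decides, and a product is
    odd exactly when both factors are. *)
Lemma exprN1_mul_oddz (a b : int) :
  (-1) ^ (a * b) = (-1) ^+ (oddz a && oddz b) :> int.
Proof.
have oddzE m : oddz m = odd `|m| by rewrite /oddz dvdzE /= dvdn2 negbK.
have exprN1z (m : int) : (-1) ^ m = (-1) ^+ oddz m :> int.
  by rewrite oddzE; case: m => m; rewrite signr_odd // -exprnN invr_sign.
by rewrite exprN1z !oddzE abszM oddM.
Qed.

Lemma rearrangement_pact (T : Type) n (f : {ffun 'I_n -> T}) (r : 'S_n) :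
  rearrangement f (pact r f).
Proof. by exists r. Qed.

(** First swap [p] and [i], which sends [q] to some [k != i]; then swap [k] and [j], which leaves
    [i] in place. *)
Lemma perm_two_points (A : finType) (p q i j : A) :
  p != q -> i != j -> exists s : {perm A}, s p = i /\ s q = j.
Proof.
move=> pq ij; pose k := tperm p i q.
have ki : k != i by rewrite -(inj_eq (@perm_inj _ (tperm p i))) tpermK tpermR eq_sym.
exists (tperm p i * tperm k j)%g; rewrite !permM -/k !tpermL.
by rewrite tpermD // eq_sym.
Qed.

Section KoszulSign.
Variables (T : Type) (deg : T -> int) (n : nat) (f : {ffun 'I_n -> T}).
Variable kappa : 'S_n -> {ffun 'I_n -> T} -> int.
Hypothesis kappaP : is_koszul_sign deg f kappa.

Lemma is_pm1_koszul_cochain (s t : 'S_n) : is_pm1 (koszul_cochain kappa f s t).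
Proof. by case: kappaP => pm1 _ _; apply: pm1; apply: rearrangement_pact. Qed.

Lemma koszul_cochainM (s t r : 'S_n) :
  koszul_cochain kappa f (permcomp s t) r
    = koszul_cochain kappa f s (permcomp t r) * koszul_cochain kappa f t r.
Proof.
case: kappaP => _ kappaM _.
by rewrite /koszul_cochain pactM kappaM //; apply: rearrangement_pact.
Qed.

Lemma delta2_koszul_cochain (u : 'S_n -> int) (s t r : 'S_n) :
  delta2 u (koszul_cochain kappa f) s t r = u s * koszul_cochain kappa f s t.
Proof.
rewrite /delta2 koszul_cochainM.
case: (is_pm1_koszul_cochain s t) => ->;
  case: (is_pm1_koszul_cochain t r) => ->;
  case: (is_pm1_koszul_cochain s (permcomp t r)) => ->;
  by rewrite ?(mulr1, mulrN1, opprK, invrN, invr1).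
Qed.

Lemma koszul_cocycleP (u : 'S_n -> int) : sign_morphism u ->
  is_2cocycle u (koszul_cochain kappa f) <->
  forall s t, koszul_cochain kappa f s t = u s.
Proof.
move=> [pm1u _]; split=> [[_ cocycle] s t | cE]; last first.
  split=> [|s t r]; first exact: is_pm1_koszul_cochain.
  by rewrite delta2_koszul_cochain cE is_pm1_mulzz.
(* The coboundary does not depend on its third argument, so any value serves there. *)
have := cocycle s t 1%g; rewrite delta2_koszul_cochain.
by case: (pm1u s) (is_pm1_koszul_cochain s t) => -> [] ->.
Qed.

(** Adjacent positions of a rearrangement carry entries of [f] with distinct indices, so their
    degrees have an even product. *)
Lemma koszul_cochain_trivial :
  (forall i j, i != j -> ~~ (oddz (deg (f i)) && oddz (deg (f j)))) ->
  forall s t, koszul_cochain kappa f s t = 1.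
Proof.
move=> not2 s t; have trivP : is_koszul_sign deg f (fun _ _ => 1).
  split=> // [? ? _|i j g [r ->] ji]; first by left.
  rewrite exprN1_mul_oddz !ffunE (negbTE (not2 _ _ _)) //.
  by rewrite (inj_eq perm_inj) -val_eqE /= ji neq_ltn leqnn.
exact: (koszul_sign_unique kappaP trivP) (rearrangement_pact f t).
Qed.

Lemma koszul_cochain_signature :
  (forall i, oddz (deg (f i))) ->
  forall s t, koszul_cochain kappa f s t = signature s.
Proof.
move=> allodd s t; have sgnP : is_koszul_sign deg f (fun s _ => signature s).
  split=> [? ? _|r1 r2 g _|i j g [r ->] ji].
  - exact: is_pm1_signr.
  - by rewrite /signature /permcomp odd_permM signr_addb mulrC.
  - rewrite exprN1_mul_oddz !ffunE !allodd /signature odd_tperm.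
    by rewrite -val_eqE /= ji neq_ltn leqnn.
exact: (koszul_sign_unique kappaP sgnP) (rearrangement_pact f t).
Qed.

Lemma koszul_cochain_const_tperm (u : 'S_n -> int) (p q i j : 'I_n) :
  (forall s t, koszul_cochain kappa f s t = u s) ->
  q = p.+1 :> nat -> i != j ->
  (-1) ^+ (oddz (deg (f i)) && oddz (deg (f j))) = u (tperm p q).
Proof.
case: kappaP => _ _ kappa_tperm cE qp ij.
have pq : p != q by rewrite -val_eqE /= qp neq_ltn leqnn.
have [s [<- <-]] := perm_two_points pq ij.
(* The inverse is needed: [pact s^-1 f] has [f (s p)] and [f (s q)] at the adjacent positions [p]
   and [q]. *)
rewrite -(cE _ s^-1%g) /koszul_cochain kappa_tperm //.
  by rewrite !ffunE invgK exprN1_mul_oddz.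
exact: rearrangement_pact.
Qed.

Lemma koszul_cochain_const_cases (u : 'S_n -> int) : (1 < n)%N ->
  (forall s t, koszul_cochain kappa f s t = u s) ->
  (forall i, oddz (deg (f i))) \/
  (forall i j, i != j -> ~~ (oddz (deg (f i)) && oddz (deg (f j)))).
Proof.
move=> n_gt1 cE; pose p := Ordinal (ltnW n_gt1); pose q := Ordinal n_gt1.
have pairE i j : i != j -> oddz (deg (f i)) && oddz (deg (f j))
    = oddz (deg (f p)) && oddz (deg (f q)).
  move=> ij; have /eqP := koszul_cochain_const_tperm cE (erefl : q = p.+1 :> nat) ij.
  rewrite -(koszul_cochain_const_tperm cE (erefl : q = p.+1 :> nat) (isT : p != q)).
  by do 2!case: (_ && _).
have [oddpq|not_odd] := boolP (oddz (deg (f p)) && oddz (deg (f q))).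
  (* Every index other than [p] is odd because its pair with [p] behaves like the pair [p], [q]. *)
  left=> i; have [->|/pairE] := eqVneq i p; first by case/andP: oddpq.
  by rewrite oddpq => /andP[].
by right=> i j /pairE ->.
Qed.

End KoszulSign.

Theorem proposition4p1 (T : Type) (deg : T -> int) (n : nat) (hn : (1 < n)%N)
    (f : {ffun 'I_n -> T}) (kappa : 'S_n -> {ffun 'I_n -> T} -> int)
    (hkappa : is_koszul_sign deg f kappa) :
  ((exists u : 'S_n -> int,
      sign_morphism u /\ is_2cocycle u (koszul_cochain kappa f))
   <->
   ((forall i j : 'I_n, oddz (deg (f i)) = oddz (deg (f j)))
    \/ (exists! i : 'I_n, oddz (deg (f i)))))
  /\
  (forall u : 'S_n -> int,
     sign_morphism u -> is_2cocycle u (koszul_cochain kappa f) ->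
     [/\ (forall s : 'S_n, u s = 1) <->
           (exists i : 'I_n, forall j : 'I_n, j != i -> ~~ oddz (deg (f j))),
         (forall s : 'S_n, u s = signature s) <->
           (forall i : 'I_n, oddz (deg (f i)))
       & forall s t : 'S_n, koszul_cochain kappa f s t = delta1 u u s t]).
Proof.
pose c := koszul_cochain kappa f; pose o i := oddz (deg (f i)).
pose p := Ordinal (ltnW hn); pose q := Ordinal hn.
have constP u := koszul_cocycleP hkappa (u := u).
have not2P : (exists i, forall j, j != i -> ~~ o j) <->
    forall i j, i != j -> ~~ (o i && o j).
  split=> [[k even] i j ij | not2].
    rewrite negb_and; have [ik|/even ->//] := eqVneq i k.
    by rewrite orbC even // -ik eq_sym.
  (* If no degree is odd, the allowed exception is arbitrary, and [p] will do. *)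
  have [k ok|even] := pickP o; last by exists p => j _; rewrite even.
  by exists k => j /not2; rewrite ok andbT.
split; first split.
- move=> [u [uP /(constP u uP) cE]].
  have [allodd|not2] := koszul_cochain_const_cases hkappa hn cE.
    by left=> i j; rewrite !allodd.
  have [k ok|even] := pickP o; last by left=> i j; rewrite -!/(o _) !even.
  right; exists k; split=> // j oj; apply/eqP/negP=> /negP/not2.
  by rewrite (ok : oddz _) oj.
- move=> parity.
  have [allodd|not2] : (forall i, o i) \/ forall i j, i != j -> ~~ (o i && o j).
    case: parity => [same|[k [ok uniq_k]]].
      (* A common parity is that of [p]; if it is even, no pair at all is odd. *)
      have [op|/negbTE op] := boolP (o p); [left=> i | right=> i j _].
        by rewrite /o (same i p).
      by rewrite /o (same i p) -/(o p) op.
    right; apply/not2P; exists k => j; apply: contra => oj.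
    by rewrite (uniq_k j).
  + have sgnP : sign_morphism (@signature n).
      split=> [s|s t]; first exact: is_pm1_signr.
      by rewrite /signature /permcomp odd_permM signr_addb mulrC.
    exists (@signature n); split=> //; apply/(constP _ sgnP).
    exact: koszul_cochain_signature hkappa allodd.
  + have oneP : sign_morphism (fun _ : 'S_n => 1) by split=> // s; left.
    exists (fun _ => 1); split=> //; apply/(constP _ oneP).
    exact: koszul_cochain_trivial hkappa not2.
- move=> u uP /(constP u uP) cE.
  have pairE := koszul_cochain_const_tperm hkappa cE (erefl : q = p.+1 :> nat).
  split=> [||s t].
  + rewrite not2P; split=> [u1 i j /pairE | not2 s].
      by rewrite u1 -!/(o _); case: (_ && _).
    by rewrite -(cE s 1%g) (koszul_cochain_trivial hkappa not2).
  + split=> [usgn | allodd s].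
      have [//|not2] := koszul_cochain_const_cases hkappa hn cE.
      (* With at most one odd degree the pair [p], [q] would give the sign 1, but the signature of a
         transposition is -1. *)
      have /pairE : p != q by [].
      by rewrite usgn /signature odd_tperm (negbTE (not2 p q _)).
    by rewrite -(cE s 1%g) (koszul_cochain_signature hkappa allodd).
  (* By multiplicativity the first three factors of [delta1 u u s t] cancel, leaving [u s], which is
     the value of the cochain. *)
  + case: uP => pm1u uM; rewrite cE /delta1 -uM is_pm1_inv //.
    by rewrite is_pm1_mulzz // mul1r.
Qed.
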